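(* Let $\mathbb{A}_i:\mathbb{X}_f\rightrightarrows\{1,\dots,n_{x_i}\}$, $i=1,\dots,N$, be index-set mappings, write $\mathcal{A}(\bm{x})=(\mathbb{A}_1(\bm{x}),\dots,\mathbb{A}_N(\bm{x}))$, and consider the original MPC problem and the associated reduced MPC problem. Let $\mathcal{M}:\mathbb{X}_f\rightrightarrows\mathbb{R}^{Nn}$ be a set-valued mapping. If for all $\bm{x}\in\mathbb{X}_f$ both $$\mathcal{X}^{\mathrm{red}\star}(\bm{x},\mathcal{A}(\bm{x}))\subseteq\mathcal{M}(\bm{x})$$ and $$\mathcal{M}(\bm{x})\cap\mathcal{X}^{\mathrm{red}}(\mathcal{A}(\bm{x}))\subseteq\mathcal{X}$$ hold, then $\mathbb{X}_f=\mathbb{X}_f^{\mathrm{red}}$ and the reduced (constraint-adaptive) MPC scheme is exact.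
   Context: Bold symbols $\bm{x},\bm{u},\dots$ denote vectors or matrices. Setting: $n,m,N$ are positive integers, $\bm{A}\in\mathbb{R}^{n\times n}$, $\bm{B}\in\mathbb{R}^{n\times m}$; the plant is $\bm{x}_{k+1}=\bm{A}\bm{x}_k+\bm{B}\bm{u}_k$. $\mathbb{X}\subseteq\mathbb{R}^n$ and $\mathbb{U}\subseteq\mathbb{R}^m$ are non-empty polyhedral sets (each the solution set of finitely many non-strict linear inequalities). For $i=1,\dots,N$, $\mathbb{X}_i=\{\bm{x}\in\mathbb{R}^n\mid \bm{c}_{i,j}\bm{x}\le b_{i,j},\ j=1,\dots,n_{x_i}\}$ with $\bm{c}_{i,j}\in\mathbb{R}^{1\times n}$, $b_{i,j}\in\mathbb{R}$. Put $\mathcal{X}=\prod_{i=1}^N\mathbb{X}_i\subseteq\mathbb{R}^{Nn}$ and $\mathcal{U}=\mathbb{U}^N\subseteq\mathbb{R}^{Nm}$. Prediction: for a state $\bm{x}\in\mathbb{R}^n$ and input sequence $\bm{U}=(\bm{u}_0,\dots,\bm{u}_{N-1})\in\mathbb{R}^{Nm}$, the predicted state sequence is $\bm{\Phi}\bm{x}+\bm{\Gamma}\bm{U}=(\bm{x}_1,\dots,\bm{x}_N)\in\mathbb{R}^{Nn}$, where $\bm{x}_0=\bm{x}$ and $\bm{x}_{i+1}=\bm{A}\bm{x}_i+\bm{B}\bm{u}_i$ (so $\bm{\Phi}$ stacks $\bm{A},\bm{A}^2,\dots,\bm{A}^N$, and $\bm{\Gamma}$ is block lower triangular with $(i,j)$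 block $\bm{A}^{i-j}\bm{B}$ for $j\le i$). The cost is $\bar J(\bm{x},\bm{U})=\ell_T(\bm{x}_N)+\sum_{i=0}^{N-1}\ell(\bm{x}_i,\bm{u}_i)$ with stage cost $\ell:\mathbb{R}^n\times\mathbb{R}^m\to\mathbb{R}$ and terminal cost $\ell_T:\mathbb{R}^n\to\mathbb{R}$. Standing assumption: $\ell$ and $\ell_T$ are continuous, $\mathcal{X}$ is closed and $\mathcal{U}$ is compact (so minimizers exist whenever the problem is feasible). Original MPC problem: minimize $\bar J(\bm{x},\bm{U})$ over $\mathcal{U}_f(\bm{x})=\{\bm{U}\in\mathcal{U}\mid \bm{\Phi}\bm{x}+\bm{\Gamma}\bm{U}\in\mathcal{X}\}$. Its set of minimizers is $\mathcal{U}^\star(\bm{x})$, and $\mathbb{X}_f=\{\bm{x}\in\mathbb{X}\mid\mathcal{U}_f(\bm{x})\ne\emptyset\}$. Reduced MPC problem: the notation $\mathbb{A}_i:\mathbb{X}_f\rightrightarrows\{1,\dots,n_{x_i}\}$ means $\mathbb{A}_i(\bm{x})\subseteq\{1,\dots,n_{x_i}\}$ for each $\bm{x}\in\mathbb{X}_f$; similarly $\mathcal{M}:\mathbb{X}_f\rightrightarrows\mathbb{R}^{Nn}$ means $\mathcal{M}(\bm{x})\subseteq\mathbb{R}^{Nn}$. For a tuple of index sets $\mathcal{A}=(\mathbb{A}_1,\dots,\mathbb{A}_N)$ put $\mathbb{X}_i^{\mathrm{red}}(\mathbb{A}_i)=\{\bm{x}\in\mathbb{R}^n\mid\bm{c}_{i,j}\bm{x}\le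 b_{i,j}\text{ for all }j\in\mathbb{A}_i\}$ and $\mathcal{X}^{\mathrm{red}}(\mathcal{A})=\prod_{i=1}^N\mathbb{X}_i^{\mathrm{red}}(\mathbb{A}_i)$. The reduced problem at $\bm{x}$ is to minimize $\bar J(\bm{x},\bm{U})$ over $\mathcal{U}_f^{\mathrm{red}}(\bm{x},\mathcal{A}(\bm{x}))=\{\bm{U}\in\mathcal{U}\mid\bm{\Phi}\bm{x}+\bm{\Gamma}\bm{U}\in\mathcal{X}^{\mathrm{red}}(\mathcal{A}(\bm{x}))\}$. Its set of minimizers is $\mathcal{U}^{\mathrm{red}\star}(\bm{x},\mathcal{A}(\bm{x}))$, and $\mathcal{X}^{\mathrm{red}\star}(\bm{x},\mathcal{A}(\bm{x}))=\bm{\Phi}\bm{x}+\bm{\Gamma}\,\mathcal{U}^{\mathrm{red}\star}(\bm{x},\mathcal{A}(\bm{x}))$ is the set of its optimal state sequences. $\mathbb{X}_f^{\mathrm{red}}$ is the set of $\bm{x}\in\mathbb{X}$ for which $\mathcal{A}(\bm{x})$ is defined (i.e. $\bm{x}\in\mathbb{X}_f$, the domain of the $\mathbb{A}_i$) and $\mathcal{U}_f^{\mathrm{red}}(\bm{x},\mathcal{A}(\bm{x}))\neq\emptyset$. Exactness: the scheme is called exact if $\mathbb{X}_f=\mathbb{X}_f^{\mathrm{red}}$ and $\mathcal{U}^\star(\bm{x})=\mathcal{U}^{\mathrm{red}\star}(\bm{x},\mathcal{A}(\bm{x}))$ for all $\bm{x}\in\mathbb{X}_f$. *)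

(* Defs.v *)
From HB Require Import structures.
From mathcomp Require Import all_boot all_order all_algebra.
From mathcomp Require Import all_classical all_reals all_analysis.

Set Implicit Arguments.
Unset Strict Implicit.
Unset Printing Implicit Defensive.

Import Order.TTheory GRing.Theory Num.Theory.
Import numFieldNormedType.Exports.

Local Open Scope classical_set_scope.
Local Open Scope ring_scope.

(* R^{Nd}, as column vectors made of N blocks of height d; the topology is the
   usual one of MathComp-Analysis on matrices. *)
Notation stackV R N d := 'cV[R]_(\sum_(i < N) d)%N.

Definition blk (R : realType) (N d : nat) (v : stackV R N d) (i : 'I_N) :
  'cV[R]_d := submxcol (p_ := fun=> d) v i.

Definition polyhedral (R : realType) (d : nat) (S : set 'cV[R]_d) : Prop :=
  exists (p : nat) (C : 'M[R]_(p, d)) (e : 'cV[R]_p),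
    S = [set x | forall j : 'I_p, (C *m x) j 0 <= e j 0].

Definition minimizers (R : realType) (T : Type) (f : T -> R) (S : set T) :
  set T := [set u | S u /\ forall v, S v -> f u <= f v].

(* Time indices are shifted: i : 'I_N in [ncon], [ccoef], [cbound] refers to
   the constraint set on the (i+1)-st predicted state. *)
Record mpc (R : realType) (n m N : nat) := Mpc {
  dynA : 'M[R]_n;
  dynB : 'M[R]_(n, m);
  stateX : set 'cV[R]_n;
  inputU : set 'cV[R]_m;
  ncon : 'I_N -> nat;
  ccoef : forall i : 'I_N, 'I_(ncon i) -> 'rV[R]_n;
  cbound : forall i : 'I_N, 'I_(ncon i) -> R;
  stageL : 'cV[R]_n -> 'cV[R]_m -> R;
  termL : 'cV[R]_n -> R }.

Definition Xi (R : realType) (n m N : nat) (P : mpc R n m N) (i : 'I_N) :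
  set 'cV[R]_n :=
  [set x | forall j : 'I_(ncon P i), (ccoef j *m x) 0 0 <= cbound j].

Definition Xprod (R : realType) (n m N : nat) (P : mpc R n m N) :
  set (stackV R N n) := [set z | forall i : 'I_N, Xi P i (blk z i)].

Definition Uprod (R : realType) (n m N : nat) (P : mpc R n m N) :
  set (stackV R N m) := [set u | forall i : 'I_N, inputU P (blk u i)].

Definition Phi (R : realType) (n m N : nat) (P : mpc R n m N) :
  'M[R]_(\sum_(i < N) n, n) := \mxcol_(i < N) (dynA P ^+ i.+1).

Definition Gamma (R : realType) (n m N : nat) (P : mpc R n m N) :
  'M[R]_(\sum_(i < N) n, \sum_(j < N) m) :=
  \mxblock_(i < N, j < N)
    (if (j <= i)%N then dynA P ^+ (i - j) *m dynB P else 0).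

Definition predict (R : realType) (n m N : nat) (P : mpc R n m N)
  (x : 'cV[R]_n) (u : stackV R N m) : stackV R N n :=
  Phi P *m x + Gamma P *m u.

(* x_k for k = 0, ..., N: x_0 = x, and x_{i+1} is block i of the prediction. *)
Definition pstate (R : realType) (n m N : nat) (P : mpc R n m N)
  (x : 'cV[R]_n) (u : stackV R N m) (k : 'I_N.+1) : 'cV[R]_n :=
  if unlift ord0 k is Some i then blk (predict P x u) i else x.

Definition cost (R : realType) (n m N : nat) (P : mpc R n m N)
  (x : 'cV[R]_n) (u : stackV R N m) : R :=
  termL P (pstate P x u ord_max) +
  \sum_(i < N) stageL P (pstate P x u (widen_ord (leqnSn N) i)) (blk u i).

Definition Ufeas (R : realType) (n m N : nat) (P : mpc R n m N)
  (x : 'cV[R]_n) : set (stackV R N m) :=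
  Uprod P `&` [set u | Xprod P (predict P x u)].

Definition Ustar (R : realType) (n m N : nat) (P : mpc R n m N)
  (x : 'cV[R]_n) : set (stackV R N m) := minimizers (cost P x) (Ufeas P x).

Definition Xf (R : realType) (n m N : nat) (P : mpc R n m N) :
  set 'cV[R]_n := stateX P `&` [set x | Ufeas P x !=set0].

Definition indexsets (R : realType) (n m N : nat) (P : mpc R n m N) : Type :=
  forall i : 'I_N, {set 'I_(ncon P i)}.

Definition Xired (R : realType) (n m N : nat) (P : mpc R n m N) (i : 'I_N)
  (Ai : {set 'I_(ncon P i)}) : set 'cV[R]_n :=
  [set x | forall j, j \in Ai -> (ccoef j *m x) 0 0 <= cbound j].

Definition Xred (R : realType) (n m N : nat) (P : mpc R n m N)
  (A : indexsets P) : set (stackV R N n) :=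
  [set z | forall i : 'I_N, Xired (A i) (blk z i)].

Definition Ured (R : realType) (n m N : nat) (P : mpc R n m N)
  (x : 'cV[R]_n) (A : indexsets P) : set (stackV R N m) :=
  Uprod P `&` [set u | Xred A (predict P x u)].

Definition Uredstar (R : realType) (n m N : nat) (P : mpc R n m N)
  (x : 'cV[R]_n) (A : indexsets P) : set (stackV R N m) :=
  minimizers (cost P x) (Ured x A).

Definition Xredstar (R : realType) (n m N : nat) (P : mpc R n m N)
  (x : 'cV[R]_n) (A : indexsets P) : set (stackV R N n) :=
  predict P x @` Uredstar x A.

(* The index-set mappings have exactly the feasible states as domain: [Xf P]
   is used here as the subtype of its elements. *)
Definition indexmaps (R : realType) (n m N : nat) (P : mpc R n m N) : Type :=
  forall i : 'I_N, Xf P -> {set 'I_(ncon P i)}.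

Definition mapsAt (R : realType) (n m N : nat) (P : mpc R n m N)
  (A : indexmaps P) (x : Xf P) : indexsets P := fun i => A i x.

Definition Xfred (R : realType) (n m N : nat) (P : mpc R n m N)
  (A : indexmaps P) : set 'cV[R]_n :=
  [set x | stateX P x /\
    exists2 y : Xf P, set_val y = x & Ured (set_val y) (mapsAt A y) !=set0].

Definition exact_scheme (R : realType) (n m N : nat) (P : mpc R n m N)
  (A : indexmaps P) : Prop :=
  Xf P = Xfred A /\
  forall x : Xf P, Ustar P (set_val x) = Uredstar (set_val x) (mapsAt A x).

(* The stacked prediction is the trajectory of the plant. *)
Lemma pstate0 (R : realType) (n m N : nat) (P : mpc R n m N) x u :
  pstate P x u ord0 = x.
Proof. by rewrite /pstate unlift_none. Qed.

Lemma blk_predict (R : realType) (n m N : nat) (P : mpc R n m N) x u i :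
  blk (predict P x u) i = dynA P ^+ i.+1 *m x +
    \sum_(j < N | (j <= i)%N) (dynA P ^+ (i - j) *m dynB P *m blk u j).
Proof.
have uE : u = \mxcol_j blk u j by rewrite -[LHS](submxcolK (p_ := fun=> m)).
rewrite /blk /predict submxcolD /Phi /Gamma; congr (_ + _).
  by rewrite -submxcol_mul mxcolK.
rewrite {1}uE mul_mxblock_mxrow mxcolK [RHS]big_mkcond /=.
by apply: eq_bigr => j _; case: ifP => // _; rewrite mul0mx.
Qed.

Lemma pstateS (R : realType) (n m N : nat) (P : mpc R n m N) x u (i : 'I_N) :
  pstate P x u (lift ord0 i) =
  dynA P *m pstate P x u (widen_ord (leqnSn N) i) + dynB P *m blk u i.
Proof.
have exS k : dynA P ^+ k.+1 = dynA P *m dynA P ^+ k by rewrite exprS.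
rewrite /pstate liftK blk_predict (bigD1 i) //= subnn expr0 mul1mx.
rewrite [X in _ + X]addrC addrA; congr (_ + _).
case: unliftP => [k ik|i0].
  have ik1 : i = k.+1 :> nat.
    by move/(congr1 val): ik; rewrite /= /bump.
  rewrite blk_predict mulmxDr ik1 mulmxA -exS; congr (_ + _).
  have jE (j : 'I_N) : (j <= k.+1)%N && (j != i) = (j <= k)%N.
    by rewrite -[RHS]ltnS ltn_neqAle andbC -(inj_eq val_inj) /= ik1.
  rewrite mulmx_sumr; apply: eq_big => [//|j]; rewrite jE => jk.
  by rewrite subSn// exS -!mulmxA.
have i00 : i = 0%N :> nat by move/(congr1 val): i0.
rewrite big1 ?addr0 ?i00 ?expr1// => j /andP[].
by rewrite leqn0 -(inj_eq val_inj) /= i00 => ->.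
Qed.

(* Main.v *)
(* The reduced problem relaxes the original one.  Its minimizers, which exist by
   compactness, satisfy the original constraints by the two inclusions, so both
   problems have the same optimal value; hence a minimizer of the original
   problem is also one of the reduced problem. *)

Require Import Defs.
From mathcomp Require Import all_boot all_order all_algebra.
From mathcomp Require Import all_classical all_reals all_analysis.

Import Order.TTheory GRing.Theory Num.Theory.
Import numFieldNormedType.Exports.

Local Open Scope classical_set_scope.
Local Open Scope ring_scope.

(** A neighbourhood of a matrix contains a box of neighbourhoods of its entries. As there are
    finitely many entries, the conditions on them hold simultaneously near [t]. *)
Lemma continuous_mx (T : topologicalType) (K : topologicalType) (p q : nat)
    (f : T -> 'M[K]_(p, q)) :
  (forall i j, continuous (fun t => f t i j)) -> continuous f.
Proof.
move=> fc t B [Q tQ QB].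
have : \forall s \near t, forall i j, Q i j (f s i j).
  by apply: filter_forall => i; apply: filter_forall => j; exact: (fc i j t).
by apply: filterS => s Qs; exact: QB.
Qed.

Lemma continuous_mulmx (R : realType) (p q r : nat) (C : 'M[R]_(p, q)) :
  continuous (fun x : 'M[R]_(q, r) => C *m x).
Proof.
apply: continuous_mx => i j.
under eq_fun do rewrite mxE.
apply: continuous_big => [|k _ x]; first exact: add_continuous.
apply: (@continuousM R _ (fun=> C i k) (fun y : 'M[R]_(q, r) => y k j) x).
  exact: cst_continuous.
exact: coord_continuous.
Qed.

Lemma continuous_blk (R : realType) (N d : nat) (i : 'I_N) :
  continuous (fun v : stackV R N d => blk v i).
Proof.
apply: continuous_mx => j k.
(* Each entry of a block is a single coordinate of the stacked vector, at the row that [tagnat.Rank]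
   assigns to row [j] of block [i]. *)
suff -> : (fun v : stackV R N d => blk v i j k) =
    (fun v => v (tagnat.Rank (p_ := fun=> d) i j) k) by exact: coord_continuous.
by apply/funext => v; rewrite mxE.
Qed.

Lemma continuous_predict (R : realType) (n m N : nat) (P : mpc R n m N) x :
  continuous (predict P x).
Proof.
move=> u.
apply: (@continuousD _ _ _ (fun=> Phi P *m x) (fun u => Gamma P *m u) u).
  exact: cst_continuous.
exact: continuous_mulmx.
Qed.

Lemma continuous_pstate (R : realType) (n m N : nat) (P : mpc R n m N) x k :
  continuous (fun u => pstate P x u k).
Proof.
(* The [None] case is time 0, where the state is the fixed [x], whatever the inputs. *)
move=> u; rewrite /pstate; case: unlift => [i|]; last exact: cst_continuous.
apply: (@continuous_comp _ _ _ (predict P x) (fun v => blk v i)).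
  exact: continuous_predict.
exact: continuous_blk.
Qed.

Lemma continuous_cost (R : realType) (n m N : nat) (P : mpc R n m N) x :
  continuous (fun z : 'cV[R]_n * 'cV[R]_m => stageL P z.1 z.2) ->
  continuous (termL P) -> continuous (cost P x).
Proof.
move=> stage_cont term_cont u.
apply: (@continuousD _ _ _ (fun v => termL P (pstate P x v ord_max))
  (fun v => \sum_(i < N)
     stageL P (pstate P x v (widen_ord (leqnSn N) i)) (blk v i)) u).
  apply: (@continuous_comp _ _ _ (fun v => pstate P x v ord_max)).
    exact: continuous_pstate.
  exact: term_cont.
move: u; apply: continuous_big => [|i _ u]; first exact: add_continuous.
(* State and input both vary with the input sequence, so the joint continuity of the stage cost is
   used along the pair of them. *)
apply: (@continuous_comp _ _ _
  (fun v => (pstate P x v (widen_ord (leqnSn N) i), blk v i))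
  (fun z => stageL P z.1 z.2)); last exact: stage_cont.
exact: cvg_pair (@continuous_pstate _ _ _ _ P x _ u) (@continuous_blk _ _ _ i u).
Qed.

(** The set is an intersection of preimages of closed half-lines under continuous maps, one for each
    retained constraint. *)
Lemma closed_Xred (R : realType) (n m N : nat) (P : mpc R n m N)
  (A : indexsets P) : closed (Xred A).
Proof.
have -> : Xred A = \bigcap_i \bigcap_(j in [set j | j \in A i])
    ((fun z => (ccoef j *m blk z i) 0 0) @^-1` [set y | y <= cbound j]).
  by apply/seteqP; split=> z Az i => [_ j|j] jA; [exact: Az|exact: (Az i I j)].
apply: closed_bigI => i _; apply: closed_bigI => j _.
apply: preimage_closed; last exact: closed_le.
move=> z _; apply: (@continuous_comp _ _ _ (fun z => ccoef j *m blk z i)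
  (fun y : 'M[R]_1 => y 0 0)); last exact: coord_continuous.
apply: (@continuous_comp _ _ _ (fun z => blk z i)); first exact: continuous_blk.
exact: continuous_mulmx.
Qed.

Lemma Ufeas_sub_Ured (R : realType) (n m N : nat) (P : mpc R n m N) x
  (A : indexsets P) : Ufeas P x `<=` Ured x A.
Proof. by move=> u [Uu Xu]; split=> // i j _; exact: Xu. Qed.

(** Extreme value theorem: the reduced feasible set is the compact [Uprod P] cut by the preimage of
    the closed [Xred A] under the continuous prediction map. *)
Lemma Uredstar_neq0 (R : realType) (n m N : nat) (P : mpc R n m N) x
    (A : indexsets P) :
  continuous (fun z : 'cV[R]_n * 'cV[R]_m => stageL P z.1 z.2) ->
  continuous (termL P) -> compact (Uprod P) ->
  Ured x A !=set0 -> Uredstar x A !=set0.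
Proof.
move=> stage_cont term_cont compactU Ured0.
have compactUred : compact (Ured x A).
  apply: compact_closedI => //.
  apply: (@preimage_closed _ _ (predict P x)); last exact: closed_Xred.
  by move=> u _; exact: continuous_predict.
have [|u uU umin] := compact_EVT_min (f := cost P x) Ured0 compactUred.
  by apply: continuous_subspaceT; exact: continuous_cost.
by exists u; split=> [|v vU]; [rewrite -inE|apply: umin; rewrite inE].
Qed.

(** A minimizer [w] over [S'] lies in [S], so a minimizer [u] over [S] satisfies [f u <= f w <= f v]
    for every [v] in [S']. *)
Lemma minimizers_eq (R : realType) (T : Type) (f : T -> R) (S S' : set T) :
  S `<=` S' -> minimizers f S' `<=` S -> minimizers f S' !=set0 ->
  minimizers f S = minimizers f S'.
Proof.
move=> SS' minS [w [wS' wmin]]; apply/seteqP; split=> u [uS umin].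
  split=> [|v vS']; first exact: SS'.
  by apply: le_trans (wmin v vS'); apply: umin; exact: minS.
by split=> [|v /SS']; [exact: minS|exact: umin].
Qed.

Theorem theorem1 (R : realType) (n m N : nat) (P : mpc R n m N)
    (n_gt0 : (0 < n)%N) (m_gt0 : (0 < m)%N) (N_gt0 : (0 < N)%N)
    (polyX : polyhedral (stateX P)) (X_neq0 : stateX P !=set0)
    (polyU : polyhedral (inputU P)) (U_neq0 : inputU P !=set0)
    (stage_cont : continuous
       (fun z : 'cV[R]_n * 'cV[R]_m => stageL P z.1 z.2))
    (term_cont : continuous (termL P))
    (closed_Xprod : closed (Xprod P))
    (compact_Uprod : compact (Uprod P))
    (A : forall i : 'I_N, Xf P -> {set 'I_(ncon P i)})
    (M : Xf P -> set (stackV R N n))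
    (sub_M : forall x : Xf P,
       Xredstar (set_val x) (mapsAt A x) `<=` M x)
    (M_sub : forall x : Xf P,
       M x `&` Xred (mapsAt A x) `<=` Xprod P) :
  Xf P = Xfred A /\ exact_scheme A.
Proof.
have Ured0 (x : Xf P) : Ured (set_val x) (mapsAt A x) !=set0.
  have [_ [u uU]] : Xf P (set_val x) by exact: set_valP.
  by exists u; exact: Ufeas_sub_Ured.
have XfE : Xf P = Xfred A.
  (* One inclusion is [Ured0] at [x] packed into the subtype; the other holds because the index-set
     maps have domain [Xf P]. *)
  apply/seteqP; split=> [x xX|x [_ [y <- _]]]; last exact: set_valP.
  by split; [case: xX|exists (SigSub (mem_set xX))].
split=> //; split=> // x; apply: minimizers_eq.
- exact: Ufeas_sub_Ured.
(* The prediction from [u] is in [M x] because [u] is optimal, and in the reduced constraint set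
   because [u] is feasible; the second inclusion then gives all the original constraints. *)
- move=> u ustar; have [[uU uX] _] := ustar; split=> //.
  by apply: (M_sub x); split=> //; apply: sub_M; exists u.
- exact: Uredstar_neq0.
Qed.
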